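(* Any bipartite absolute retract $G$ has $G^2$-connected medians; that is, for every profile $\pi$ on $G$, the median set $\mathrm{Med}(\pi)$ induces a connected subgraph of $G^2$.
   Context: Graphs are undirected, connected, without loops or multiple edges, and not necessarily finite. $d$ is the standard graph distance of $G=(V,E)$. $G^2$ has vertex set $V$, and distinct $u,v$ are adjacent iff $d(u,v)\le 2$. A profile is a map $\pi:V\to[0,\infty)$ with finite support, $F_\pi(x)=\sum_{u}\pi(u)d(u,x)$, and $\mathrm{Med}(\pi)$ is the set of vertices minimizing $F_\pi$. A retraction from a graph $H$ to a subgraph $G$ is a map $f$ from $V(H)$ onto $V(G)$ such that $f(u)f(v)$ is an edge of $G$ for every edge $uv$ of $H$, and $f(w)=w$ for all vertices $w$ of $G$. A bipartite graph $G$ is an absolute retract (in the category of bipartite graphs), i.e. a bipartite absolute retract, if for every isometric (distance-preserving) embedding $\iota$ of $G$ into a bipartite graph $H$ there exists a retraction from $H$ to $\iota(G)$. *)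

(* Defs.v *)
From HB Require Import structures.
From mathcomp Require Import all_boot all_order all_algebra.
From mathcomp Require Import all_classical all_reals.

Set Implicit Arguments.
Unset Strict Implicit.
Unset Printing Implicit Defensive.

Import Order.TTheory GRing.Theory Num.Theory.

Local Open Scope classical_set_scope.
Local Open Scope ring_scope.

(* [A] induces a (nonempty) connected subgraph of the graph with edge
   relation [e]: any two vertices of [A] are joined by a walk that stays
   in [A]. *)
Definition induces_connected (V : choiceType) (e : rel V) (A : set V) : Prop :=
  A !=set0 /\
  forall u v : V, A u -> A v ->
    exists p : seq V, [/\ path e u p, last u p = v & [set` p] `<=` A].

(* Simple connected graphs of arbitrary cardinality. Classically, every type is
   a choiceType and every relation is boolean, so this loses no generality. *)
Record graph := Graph {
  vertex :> choiceType;
  adj : rel vertex;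
  adj_sym : symmetric adj;
  adj_irr : irreflexive adj;
  adj_connected : induces_connected adj [set: vertex]
}.

Definition walk (G : graph) (n : nat) (u v : G) : Prop :=
  exists p : seq G, [/\ path (@adj G) u p, last u p = v & size p = n].

Lemma walk_exists (G : graph) (u v : G) : exists n, `[< walk n u v >].
Proof.
have [_ /(_ u v I I) [p [up pv _]]] := adj_connected G.
by exists (size p); apply/asboolP; exists p.
Qed.

Definition dist (G : graph) (u v : G) : nat := ex_minn (walk_exists u v).

Definition square_adj (G : graph) : rel G :=
  fun u v => (u != v) && (dist u v <= 2)%N.

Definition bipartite (G : graph) : Prop :=
  exists c : G -> bool, forall u v : G, adj u v -> c u != c v.

Definition isometric (G H : graph) (iota : G -> H) : Prop :=
  forall u v : G, dist (iota u) (iota v) = dist u v.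

(* The edges of the subgraph [iota(G)] of [H]; its vertex set is
   [range iota]. *)
Definition image_adj (G H : graph) (iota : G -> H) (x y : H) : Prop :=
  exists u v : G, [/\ adj u v, iota u = x & iota v = y].

(* [f] is a retraction from [H] to its subgraph with vertex set [S] and edge
   relation [eS]. *)
Definition retraction (H : graph) (S : set H) (eS : H -> H -> Prop)
    (f : H -> H) : Prop :=
  [/\ range f = S,
      forall u v : H, adj u v -> eS (f u) (f v)
    & forall w : H, S w -> f w = w].

Definition bipartite_absolute_retract (G : graph) : Prop :=
  bipartite G /\
  forall (H : graph) (iota : G -> H), bipartite H -> isometric iota ->
    exists f : H -> H, retraction (range iota) (image_adj iota) f.

Record profile (R : realType) (G : graph) := Profile {
  weight :> G -> R;
  weight_ge0 : forall u : G, 0 <= weight u;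
  weight_finite_support : finite_set [set u | weight u != 0]
}.

Definition total_dist (R : realType) (G : graph) (pi : profile R G)
    (x : G) : R :=
  \sum_(u \in [set: G]) pi u * (dist u x)%:R.

Definition Med (R : realType) (G : graph) (pi : profile R G) : set G :=
  [set x | forall y : G, total_dist pi x <= total_dist pi y].

(* Main.v *)
Require Import Defs.
From mathcomp Require Import all_boot all_order all_algebra.
From mathcomp Require Import all_classical all_reals.
From mathcomp Require Import zify lra finmap.

(** For any two medians u and v at distance k >= 3 there is a median w that is
    closer to each of them than k, and induction on k then yields a walk of
    medians from u to v in the square of G.

    Put a = d(u,x), b = d(v,x), let s be 1 if k is odd and 2 if k is even, and
    consider

      f(x) = a + s sgn(b - a),     g(x) = b + s sgn(a - b).

    Let F be the total distance. If w and w' satisfy d(w,x) <= f(x) and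
    d(w',x) <= g(x) for all x, then f + g = a + b gives
    F(w) + F(w') <= F(u) + F(v), so w and w' are medians
    ([Med_shift]); moreover d(w,u) <= f(u) = s and d(w,v) <= f(v) = k - s are
    smaller than k.

    Such a w exists as soon as f is 1-Lipschitz, f(x) + f(y) >= d(x,y), and
    f(x) - d(u,x) has constant parity ([absolute_retract_radius]). Indeed, let H
    be the graph of the integer functions on G that differ from d(u, .) by a
    bounded amount of constant parity, two functions being adjacent when they
    differ by exactly 1 at every point. It is bipartite, G embeds in it
    isometrically by x |-> d(x, .), and the three conditions on f ensure that
    the function f, as a vertex of H, is at distance at most f(x) from the image
    of each x. A retraction of H onto G does not increase distances and so sends
    f to the required w.

    Why f meets these conditions ([shift_dist_vertex]): since a - b has the
    parity of k, either a = b or |a - b| >= s. Where f subtracts s from a, the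
    value a - s is still at least b; so in the inequality f(x) + f(y) >= d(x,y)
    either no more is subtracted at one point than is added at the other, and
    d(x,y) <= d(u,x) + d(u,y) suffices, or f is at least d(v, .) at both points.
    The Lipschitz condition holds for the same reason, f being at most d(v, .)
    wherever s is not subtracted. *)

Set Implicit Arguments.
Unset Strict Implicit.
Unset Printing Implicit Defensive.

Import Order.TTheory GRing.Theory Num.Theory.

Local Open Scope classical_set_scope.
Local Open Scope ring_scope.

(** * Distances *)

Lemma walk_dist (G : graph) (u v : G) : walk (dist u v) u v.
Proof. by rewrite /dist; case: ex_minnP => n /asboolP. Qed.

Lemma dist_le_walk (G : graph) (n : nat) (u v : G) :
  walk n u v -> (dist u v <= n)%N.
Proof.
move=> w; rewrite /dist; case: ex_minnP => m _ /(_ n); apply; exact/asboolP.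
Qed.

Lemma dist_refl (G : graph) (u : G) : dist u u = 0%N.
Proof.
by apply/eqP; rewrite -leqn0; apply: dist_le_walk; exists [::].
Qed.

Lemma dist_eq0 (G : graph) (u v : G) : dist u v = 0%N -> u = v.
Proof. by have [p [_ <- +]] := walk_dist u v => /[swap] -> /size0nil ->. Qed.

Lemma walk_sym (G : graph) (n : nat) (u v : G) : walk n u v -> walk n v u.
Proof.
move=> [p [up <- <-]]; exists (rev (belast u p)); split.
- by rewrite rev_path (eq_path (e' := @adj G)) // => x y; rewrite adj_sym.
- by case: p up => //= x p _; rewrite rev_cons last_rcons.
- by rewrite size_rev size_belast.
Qed.

Lemma dist_sym (G : graph) (u v : G) : dist u v = dist v u.
Proof.
by apply/eqP; rewrite eqn_leq; apply/andP; split;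
  apply: dist_le_walk; apply/walk_sym/walk_dist.
Qed.

Lemma dist_triangle (G : graph) (v u w : G) :
  (dist u w <= dist u v + dist v w)%N.
Proof.
have [p [up pv <-]] := walk_dist u v; have [q [vq qw <-]] := walk_dist v w.
apply: dist_le_walk; exists (p ++ q).
by rewrite cat_path last_cat size_cat pv up vq.
Qed.

(** Each edge of a walk changes the colour, so the parity of its length is
    determined by its ends. *)
Lemma odd_dist (G : graph) (c : G -> bool) :
  (forall u v, adj u v -> c u != c v) ->
  forall u v, odd (dist u v) = c u (+) c v.
Proof.
move=> hc u v; have [p [up <- <-]] := walk_dist u v.
elim: p u up => [u _|x p IH u /= /andP[ux xp]]; first by rewrite /= addbb.
by rewrite (IH x) //; move: (hc _ _ ux); case: (c u); case: (c x); case: (c _).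
Qed.

(** * The product of lines *)

Lemma odd_distn (a b : nat) : odd `|a%:Z - b%:Z| = odd a (+) odd b.
Proof.
have [ab|/ltnW ba] := leqP a b; last by rewrite distnEl // oddB.
by rewrite distnEr // oddB // addbC.
Qed.

(** The existence of a walk of length n from f to g in the graph whose edges
    move every coordinate by exactly 1; this is why the parity matters. *)
Definition parity_close (T : Type) (n : nat) (f g : T -> int) : Prop :=
  forall t, (`|f t - g t| <= n)%N /\ odd `|f t - g t| = odd n.

Lemma parity_close_refl (T : Type) (f : T -> int) : parity_close 0 f f.
Proof. by move=> t; rewrite subrr. Qed.

Lemma parity_close_sym (T : Type) n (f g : T -> int) :
  parity_close n f g -> parity_close n g f.
Proof. by move=> fg t; rewrite distnC; exact: fg. Qed.

Lemma parity_close_trans (T : Type) m n (f g h : T -> int) :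
  parity_close m f g -> parity_close n g h -> parity_close (m + n) f h.
Proof.
move=> fg gh t; have [fg1 fg2] := fg t; have [gh1 gh2] := gh t.
split; first by lia.
by rewrite oddD -fg2 -gh2; clear; lia.
Qed.

(** Coordinates that already agree must move away, which is harmless: their
    difference 0 has the parity of n.+1, so n is at least 1. *)
Lemma parity_close_step (T : Type) n (f g : T -> int) :
  parity_close n.+1 f g ->
  exists2 h, parity_close 1 f h & parity_close n h g.
Proof.
move=> fg; exists (fun t => if f t < g t then f t + 1 else f t - 1).
  by move=> t; case: ifP; lia.
by move=> t; have [] := fg t; rewrite /=; case: ifP; lia.
Qed.

Section Lines.
Variables (T : Type) (t0 : T) (b : T -> int).

(** The functions near a base point b only, since the graph of all integer
    functions is disconnected. *)
Definition line_vertex :=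
  {classic {f : T -> int | exists n, parity_close n b f}}.

Definition line_adj : rel line_vertex :=
  fun f g => `[< parity_close 1 (sval f) (sval g) >].

Lemma line_adj_sym : symmetric line_adj.
Proof.
by move=> f g; apply/asboolP/asboolP; exact: parity_close_sym.
Qed.

(** Over an empty index set the only function would be adjacent to itself; hence
    the index t0. *)
Lemma line_adj_irr : irreflexive line_adj.
Proof. by move=> f; apply/asboolP => /(_ t0); rewrite subrr => -[]. Qed.

Lemma line_path n (f g : line_vertex) : parity_close n (sval f) (sval g) ->
  exists p, [/\ path line_adj f p, last f p = g & size p = n].
Proof.
elim: n f => [|n IH] f fg.
  exists [::]; split => //=; case: f g fg => [f Pf] [g Pg] /= fg.
  apply: eq_exist; apply/funext => t.
  by have [] := fg t; lia.
have [h fh hg] := parity_close_step fg.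
have hP : exists n, parity_close n b h.
  by have [m bf] := svalP f; exists (m + 1)%N; exact: parity_close_trans bf fh.
have [p [hp pg <-]] := IH (exist _ h hP) hg.
exists (exist _ h hP :: p); split => //=; rewrite hp andbT; exact/asboolP.
Qed.

Lemma line_adj_connected : induces_connected line_adj [set: line_vertex].
Proof.
split; first by exists (exist _ b (ex_intro _ 0%N (parity_close_refl b))).
move=> f g _ _; have [m bf] := svalP f; have [n bg] := svalP g.
have [p [fp pg _]] := line_path (parity_close_trans (parity_close_sym bf) bg).
by exists p; split.
Qed.

Definition line_graph : graph :=
  Graph line_adj_sym line_adj_irr line_adj_connected.

Lemma line_walkP n (f g : line_graph) :
  walk n f g <-> parity_close n (sval f) (sval g).
Proof.
split=> [[p [fp <- <-]]|]; last exact: line_path.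
elim: p f fp => [|h p IH] f /=; first by move=> _; exact: parity_close_refl.
move=> /andP[/asboolP fh hp]; exact: (parity_close_trans fh (IH _ hp)).
Qed.

Lemma line_bipartite : bipartite line_graph.
Proof.
exists (fun f => odd `|sval f t0|) => f g /asboolP /(_ t0) [] /=; lia.
Qed.

End Lines.

(** * Radius functions in bipartite absolute retracts *)

(** A retraction fixes the image of G and sends edges of H to images of edges
    of G, so a walk of H that ends in the image becomes a walk of G of the same
    length. *)
Lemma retraction_walk (G H : graph) (iota : G -> H) (r : H -> H) :
  injective iota -> retraction (range iota) (image_adj iota) r ->
  forall n (h : H) (w x : G), iota w = r h -> walk n h (iota x) -> walk n w x.
Proof.
move=> inj [_ radj rid] n h w x wh [p [hp px <-]].
elim: p h w wh hp px => [|h' p IH] h w wh /=.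
  move=> _ hx; exists [::]; split => //=; apply: inj.
  by rewrite wh hx rid //; exists x.
move=> /andP[hh' hp] px; have [u [v [uv ru rv]]] := radj _ _ hh'.
have [q [vq qx <-]] := IH _ _ rv hp px.
exists (v :: q); split => //=; rewrite vq andbT.
by rewrite (inj w u) // wh.
Qed.

(** The intersection property of balls by which absolute retracts are used: the
    balls of centre x and radius r x have a common point. The vertex r of the
    product of lines is such a point in an extension of G, and its image under a
    retraction is one in G. *)
Lemma absolute_retract_radius (G : graph) (z : G) (r : G -> nat) :
  bipartite_absolute_retract G ->
  (forall x y, (r x <= r y + dist x y)%N) ->
  (forall x y, (dist x y <= r x + r y)%N) ->
  (forall x, odd (r x) = odd (r z) (+) odd (dist z x)) ->
  exists w, forall x, (dist w x <= r x)%N.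
Proof.
move=> [[c hc] retr] rlip rsum rodd.
have codd := odd_dist hc.
pose d (x t : G) : int := (dist x t)%:Z.
pose H := line_graph z (d z).
have dclose x y : parity_close (dist x y) (d x) (d y).
  move=> t; split.
    have := dist_triangle x y t; have := dist_triangle y x t.
    by rewrite /d (dist_sym y x); lia.
  by rewrite odd_distn !codd; case: (c x); case: (c y); case: (c t).
have dH x : exists n, parity_close n (d z) (d x) by exists (dist z x).
pose iota (x : G) : H := exist _ (d x) (dH x).
have iiso : isometric iota.
  move=> x y; apply/eqP; rewrite eqn_leq; apply/andP; split.
    by apply/dist_le_walk/line_walkP/dclose.
  have /line_walkP/(_ y) [] := walk_dist (iota x) (iota y).
  by rewrite /= /d dist_refl; lia.
have iinj : injective iota.
  by move=> x y xy; apply: dist_eq0; rewrite -iiso xy dist_refl.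
(* The Lipschitz condition and the sum condition are the two halves of
   |r t - d(x,t)| <= r x. *)
have rclose x : parity_close (r x) (fun t => (r t)%:Z) (d x).
  move=> t; split.
    have := rlip t x; have := rsum x t.
    by rewrite /d (dist_sym t x); lia.
  rewrite odd_distn (rodd t) (rodd x) !codd.
  by case: (odd (r z)); case: (c x); case: (c z); case: (c t).
have rH : exists n, parity_close n (d z) (fun t => (r t)%:Z).
  by exists (r z); exact: parity_close_sym (rclose z).
pose f : H := exist _ _ rH.
have [rho rhoP] := retr H iota (line_bipartite _ _) iiso.
have [w _ wf] : range iota (rho f).
  by case: (rhoP) => <- _ _; exists f.
exists w => x; apply: dist_le_walk.
apply: (retraction_walk iinj rhoP wf).
exact/line_walkP/rclose.
Qed.

(** * Moving one median towards another *)

(** With n = d(u,v), a gap that every difference d(u,x) - d(v,x) <> 0 reaches in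
    a bipartite graph: this difference has the parity of n. *)
Definition stride (n : nat) : nat := if odd n then 1 else 2.

Lemma stride_bounds (n : nat) : (0 < stride n <= 2)%N.
Proof. by rewrite /stride; case: odd. Qed.

Lemma odd_stride (n : nat) : odd (stride n) = odd n.
Proof. by rewrite /stride; case: (odd n). Qed.

(** The distances from a fictitious vertex obtained from u by moving it by one
    stride towards v: those vertices x that are closer to v get closer, and
    those that are closer to u get farther away. *)
Definition shift_dist (G : graph) (u v x : G) : nat :=
  if (dist u x < dist v x)%N then (dist u x + stride (dist u v))%N
  else if (dist v x < dist u x)%N then (dist u x - stride (dist u v))%N
  else dist u x.

Variant shift_dist_spec (G : graph) (u v x : G) : nat -> Prop :=
  | ShiftAway of (dist u x + stride (dist u v) <= dist v x)%N :
      shift_dist_spec u v x (dist u x + stride (dist u v))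
  | ShiftToward n of dist u x = (n + stride (dist u v))%N & (dist v x <= n)%N :
      shift_dist_spec u v x n
  | ShiftNone of dist u x = dist v x : shift_dist_spec u v x (dist u x).

(** Since unequal distances d(u,x) and d(v,x) differ by at least a stride, the
    shift never carries d(u,x) past d(v,x). *)
Lemma shift_distP (G : graph) (u v x : G) : bipartite G ->
  shift_dist_spec u v x (shift_dist u v x).
Proof.
move=> [c /odd_dist codd].
have par : odd (dist u x) (+) odd (dist v x) = odd (dist u v).
  by rewrite !codd; case: (c u); case: (c v); case: (c x).
rewrite /shift_dist; case: ltngtP => [ab|ba|]; last exact: ShiftNone.
  by apply: ShiftAway; move: ab par; rewrite /stride; case: (odd (dist u v)); lia.
by apply: ShiftToward; move: ba par; rewrite /stride; case: (odd (dist u v)); lia.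
Qed.

Lemma shift_distD (G : graph) (u v x : G) : bipartite G ->
  (shift_dist u v x + shift_dist v u x = dist u x + dist v x)%N.
Proof.
move=> bipG; have := stride_bounds (dist u v).
case: (shift_distP u v x bipG); case: (shift_distP v u x bipG);
  rewrite ?(dist_sym v u); lia.
Qed.

(** A point at which a stride is subtracted still has shifted distance at least
    d(v,x), and any other point has shifted distance at most d(v,x): each of
    the conditions of [absolute_retract_radius] then reduces to a triangle
    inequality through u or through v. *)
Lemma shift_dist_vertex (G : graph) (u v : G) :
  bipartite_absolute_retract G ->
  exists w, forall x, (dist w x <= shift_dist u v x)%N.
Proof.
move=> barG; have [bipG _] := barG.
apply: (@absolute_retract_radius _ u _ barG).
- move=> x y.
  have := dist_triangle x u y; have := dist_triangle y u x.
  have := dist_triangle x v y; have := dist_triangle y v x.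
  rewrite (dist_sym y x).
  by case: (shift_distP u v x bipG); case: (shift_distP u v y bipG); lia.
- move=> x y.
  have := dist_triangle u x y; have := dist_triangle v x y.
  rewrite (dist_sym x u) (dist_sym x v).
  by case: (shift_distP u v x bipG); case: (shift_distP u v y bipG); lia.
- move=> x; have [c /odd_dist codd] := bipG.
  have step y : odd (shift_dist u v y) = odd (dist u y) (+) odd (dist u v).
    case: (shift_distP u v y bipG) => [_|n -> _|uy].
    - by rewrite oddD odd_stride.
    - by rewrite oddD odd_stride addbK.
    - have : odd (dist u y) = odd (dist v y) by rewrite uy.
      by rewrite !codd; case: (c u); case: (c v); case: (c y).
  by rewrite !step dist_refl addbC.
Qed.

(** * Medians *)

(** The support as a finite index type of positive weights. *)
Lemma total_distE (R : realType) (G : graph) (pi : profile R G) :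
  exists2 S : {fset G}, forall u : S, 0 < weight pi (val u) &
    forall x, total_dist pi x =
      \sum_(u : S) weight pi (val u) * (dist (val u) x)%:R.
Proof.
have finS := @weight_finite_support _ _ pi.
exists (fset_set [set u | weight pi u != 0]) => [u|x].
  by have := valP u; rewrite in_fset_set // in_setE /= lt_def weight_ge0 => ->.
rewrite /total_dist (fsbigTE (fset_set [set u | weight pi u != 0])).
  by rewrite big_seq_fsetE.
move=> u; rewrite in_fset_set // notin_setE /= => /negP.
by rewrite negbK => /eqP ->; rewrite mul0r.
Qed.

(** On the support of pi the weights are positive, so a vertex of total distance
    at most M is at bounded distance from each point of the support. The total
    distance depends only on the vector of these distances, and below M this
    vector takes finitely many values, one of which is optimal. *)
Lemma Med_nonempty (R : realType) (G : graph) (pi : profile R G) :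
  Med pi !=set0.
Proof.
have [[x0 _] _] := adj_connected G; have [S wpos FE] := total_distE pi.
have term_ge0 x (u : S) : 0 <= weight pi (val u) * (dist (val u) x)%:R.
  by rewrite mulr_ge0 // ltW.
pose M := total_dist pi x0.
have [N NP] : exists N, forall x, total_dist pi x <= M ->
    forall u : S, (dist (val u) x < N)%N.
  have bound (u : S) : exists n, forall x, total_dist pi x <= M ->
      (dist (val u) x < n)%N.
    exists (Num.bound (M / weight pi (val u))) => x xM.
    rewrite -(ltr_nat R); apply: le_lt_trans (archi_boundP _); last first.
      by rewrite divr_ge0 ?(ltW (wpos u)) // /M FE sumr_ge0.
    rewrite ler_pdivlMr // mulrC; apply: le_trans xM; rewrite FE.
    by rewrite (bigD1 u) //= lerDl sumr_ge0 // => v _; exact: term_ge0.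
  have [n nP] := choice bound.
  exists (\max_(u : S) n u)%N => x xM u.
  exact: leq_trans (nP u x xM) (leq_bigmax u).
(* The strict bound N lets the vectors of distances live in a finite type. *)
pose V := {ffun S -> 'I_N}.
pose realized (t : V) :=
  `[< exists x, forall u, t u = dist (val u) x :> nat >].
pose cost (t : V) : R := \sum_(u : S) weight pi (val u) * (t u)%:R.
have vecP x (xM : total_dist pi x <= M) :
    exists2 t, realized t & total_dist pi x = cost t.
  exists [ffun u => Ordinal (NP x xM u)].
    by apply/asboolP; exists x => u; rewrite ffunE.
  by rewrite FE; apply: eq_bigr => u _; rewrite ffunE.
have [t0 t0P t0M] := vecP x0 (lexx _).
have [t /asboolP[x tx] tmin] := arg_minP cost t0P.
have xt : total_dist pi x = cost t.
  by rewrite FE; apply: eq_bigr => u _; rewrite tx.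
exists x => y; have [yM|/ltW My] := leP (total_dist pi y) M.
  by have [t' t'P ->] := vecP y yM; rewrite xt; exact: tmin.
by apply: le_trans My; rewrite xt /M t0M; exact: tmin.
Qed.

(** Shifting u towards v and v towards u preserves the sum of the two distances
    to each x, hence the sum of the two total distances, which is minimal. *)
Lemma Med_shift (R : realType) (G : graph) (pi : profile R G) (u v w w' : G) :
  bipartite G -> Med pi u -> Med pi v ->
  (forall x, (dist w x <= shift_dist u v x)%N) ->
  (forall x, (dist w' x <= shift_dist v u x)%N) ->
  Med pi w.
Proof.
move=> bipG Mu Mv ww ww'.
suff le2 :
    total_dist pi w + total_dist pi w' <= total_dist pi u + total_dist pi v.
  move=> y; apply: le_trans (Mu y).
  by have := Mv w'; lra.
have [S wpos FE] := total_distE pi.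
rewrite !FE -!big_split /=; apply: ler_sum => x _.
rewrite -!mulrDr -!natrD ler_wpM2l ?weight_ge0 // ler_nat.
rewrite !(dist_sym (val x)) -(shift_distD u v) //; exact: leq_add.
Qed.

Theorem proposition62 (R : realType) (G : graph) (pi : profile R G) :
  bipartite_absolute_retract G ->
  induces_connected (@square_adj G) (Med pi).
Proof.
move=> barG; have [bipG _] := barG; split; first exact: Med_nonempty.
move=> u v; have [k] := ubnP (dist u v); elim: k u v => // k IH u v duv Mu Mv.
have [near|far] := leqP (dist u v) 2.
  have [->|uv] := eqVneq u v; first by exists [::].
  exists [:: v]; split => //=; first by rewrite /square_adj uv near.
  by move=> x /=; rewrite inE => /eqP ->.
have [w wP] := shift_dist_vertex u v barG.
have [w' w'P] := shift_dist_vertex v u barG.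
have Mw := Med_shift bipG Mu Mv wP w'P.
have s12 := stride_bounds (dist u v).
have uw : (dist u w < dist u v)%N.
  rewrite dist_sym; apply: leq_ltn_trans (wP u) _.
  case: (shift_distP u v u bipG); rewrite dist_refl (dist_sym v u); lia.
have wv : (dist w v < dist u v)%N.
  apply: leq_ltn_trans (wP v) _.
  case: (shift_distP u v v bipG); rewrite dist_refl; lia.
have [p [up pw pM]] := IH u w (leq_trans uw duv) Mu Mw.
have [q [wq qv qM]] := IH w v (leq_trans wv duv) Mw Mv.
exists (p ++ q); split; first by rewrite cat_path up pw.
- by rewrite last_cat pw.
- by move=> x /=; rewrite mem_cat => /orP[/pM|/qM].
Qed.
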